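(* Let $A$ be a discrete abelian group such that $Ext_{tfu}(X,A)=0$ for all groups $X\in\ell$. Then $A$ is a reduced group and $A/tA$ is a divisible group.
   Context: All groups are Hausdorff topological abelian groups, written additively. $\ell$ is the category of locally compact abelian (LCA) groups with continuous homomorphisms as morphisms. A morphism is proper if it is open onto its image. An extension of $A$ by $C$ in $\ell$ is a short exact sequence $0\to A\stackrel{\phi}{\to}B\stackrel{\psi}{\to}C\to 0$ in $\ell$ in which $\phi$ and $\psi$ are proper morphisms. For a group $G$, $G^{(1)}=\bigcap_{n\ge 1}nG$ is the first Ulm subgroup, and $\overline{S}$ denotes the closure of $S$. Such an extension is a $TFU$ extension if $0\to\overline{A^{(1)}}\stackrel{\overline{\phi}}{\to}\overline{B^{(1)}}\stackrel{\overline{\psi}}{\to}\overline{C^{(1)}}\to 0$ is an extension, where $\overline{\phi}=\phi|_{\overline{A^{(1)}}}$ and $\overline{\psi}=\psi|_{\overline{B^{(1)}}}$. Two extensions $0\to A\stackrel{\phi_1}{\to}B\stackrel{\psi_1}{\to}C\to 0$ and $0\to A\stackrel{\phi_2}{\to}X\stackrel{\psi_2}{\to}C\to 0$ are equivalent if there is a topological isomorphism $\beta:B\to X$ with $\beta\phi_1=\phi_2$ and $\psi_2\beta=\psi_1$. An extension splits if it is equivalent to the trivial extension $0\to A\to A\oplus C\to C\to 0$. $Ext_{tfu}(C,A)$ is the class of all equivalence classes of $TFU$ extensions of $A$ by $C$, and $Ext_{tfu}(C,A)=0$ means that every $TFU$ extension of $A$ by $C$ splits. $tA$ is the maximal torsion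 subgroup of $A$. $G$ is divisible if $nG=G$ for every positive integer $n$, and reduced if its only divisible subgroup is $0$. *)

(* Defs.v *)
From HB Require Import structures.
From mathcomp Require Import all_boot all_order all_algebra.
From mathcomp Require Import generic_quotient ring_quotient.
From mathcomp Require Import all_classical.
From mathcomp Require Import topology tvs.

Set Implicit Arguments.
Unset Strict Implicit.
Unset Printing Implicit Defensive.

Import GRing.Theory.
Local Open Scope classical_set_scope.
Local Open Scope ring_scope.

HB.mixin Record isLCA G & TopologicalZmodule G := {
  lca_hausdorff : hausdorff_space G;
  lca_locally_compact : locally_compact [set: G]
}.

#[short(type="lcaType")]
HB.structure Definition LCA := {G of TopologicalZmodule G & isLCA G}.

#[short(type="lcaHom")]
HB.structure Definition LCAHom (A B : lcaType) :=
  {f of @isContinuous A B f & @GRing.Additive A B f}.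

Definition nmultiples (G : zmodType) (n : nat) (S : set G) : set G :=
  [set x *+ n | x in S].

Definition divisible (G : zmodType) (S : set G) : Prop :=
  forall n, (0 < n)%N -> nmultiples n S = S.

Definition reduced (G : zmodType) : Prop :=
  forall S : zmodClosed G, divisible [set` S] -> [set` S] = [set 0].

Definition torsion (G : zmodType) : {pred G} :=
  fun x => `[< exists2 n, (0 < n)%N & x *+ n = 0 >].
Arguments torsion : clear implicits.

Lemma torsion_zmod_closed (G : zmodType) : zmod_closed (torsion G).
Proof.
split=> [|x y /asboolP[m m0 xm] /asboolP[n n0 yn]].
  by apply/asboolP; exists 1%N.
apply/asboolP; exists (m * n)%N; first by rewrite muln_gt0 m0.
by rewrite mulrnBl {1}mulrnA xm mul0rn mulnC mulrnA yn mul0rn subrr.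
Qed.

HB.instance Definition _ (G : zmodType) :=
  GRing.isZmodClosed.Build G (torsion G) (@torsion_zmod_closed G).

Definition ulm (G : zmodType) : set G :=
  \bigcap_(n in [set n | (0 < n)%N]) nmultiples n [set: G].
Arguments ulm : clear implicits.

Lemma ulm0 (G : zmodType) : ulm G 0.
Proof. by move=> n _; exists 0; rewrite ?mul0rn. Qed.

Lemma ulmB (G : zmodType) (x y : G) : ulm G x -> ulm G y -> ulm G (x - y).
Proof.
move=> ux uy n n0; have [a _ <-] := ux n n0; have [b _ <-] := uy n n0.
by exists (a - b); rewrite ?mulrnBl.
Qed.

Definition in_closure_ulm (G : topologicalZmodType) : pred G :=
  fun x => x \in closure (ulm G).
Arguments in_closure_ulm : clear implicits.

Lemma closure_ulm_zmod_closed (G : topologicalZmodType) :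
  zmod_closed (in_closure_ulm G).
Proof.
split=> [|x y]; first exact/mem_set/subset_closure/ulm0.
rewrite -!topredE /= /in_closure_ulm !in_setE => cx cy U nU.
have [[V W] [/= nV nW] VW] := @sub_continuous G (x, y) U nU.
have [v [uv Vv]] := cx _ nV; have [w [uw Ww]] := cy _ nW.
by exists (v - w); split; [exact: ulmB|exact: (VW (v, w))].
Qed.

HB.instance Definition _ (G : topologicalZmodType) :=
  GRing.isZmodClosed.Build G (in_closure_ulm G) (@closure_ulm_zmod_closed G).

(* The closed subgroup as a topological group in its own right, with the
   topology induced from G. *)
Definition ulm_closure (G : topologicalZmodType) : Type :=
  {x : G | in_closure_ulm G x}.

Section UlmClosureTopologicalGroup.
Variable G : topologicalZmodType.

HB.instance Definition _ := SubChoice.on (ulm_closure G).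
HB.instance Definition _ :=
  [SubChoice_isSubZmodule of ulm_closure G by <:].
HB.instance Definition _ := Topological.copy (ulm_closure G)
  (initial_topology (val : ulm_closure G -> G)).

Lemma ulm_closure_nbhsP (x : ulm_closure G) (U : set (ulm_closure G)) :
  nbhs x U <-> exists2 V, nbhs (val x) V & val @^-1` V `<=` U.
Proof.
split=> [[_ [[W oW <-] Wx] WU]|[V]].
  by exists W => //; exact: open_nbhs_nbhs.
rewrite nbhsE => -[W [oW Wx] WV VU]; exists (val @^-1` W); split=> //=.
  by exists W.
by move=> y /WV; exact: VU.
Qed.

Lemma ulm_closure_val_continuous : continuous (val : ulm_closure G -> G).
Proof. by move=> x V nV; apply/ulm_closure_nbhsP; exists V. Qed.

Lemma ulm_closure_continuous (T : topologicalType) (f : T -> ulm_closure G) :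
  continuous (val \o f) -> continuous f.
Proof.
move=> cf t U /ulm_closure_nbhsP[V nV VU].
have := cf t V nV; rewrite /nbhs /=; apply: (@filterS _ (nbhs t)) => z Vz.
exact: VU.
Qed.

Lemma ulm_closure_sub_continuous :
  continuous (fun x : ulm_closure G * ulm_closure G => x.1 - x.2).
Proof.
apply: ulm_closure_continuous => x.
have -> : val \o (fun x : ulm_closure G * ulm_closure G => x.1 - x.2) =
    (fun y : G * G => y.1 - y.2) \o (fun x => (val x.1, val x.2)).
  by apply/funext => y; exact: (raddfB (val : ulm_closure G -> G)).
apply: continuous_comp; last exact: sub_continuous.
apply: cvg_pair => /=.
  apply: (@continuous_comp _ _ _ fst (val : ulm_closure G -> G)).
    exact: cvg_fst.
  exact: ulm_closure_val_continuous.
apply: (@continuous_comp _ _ _ snd (val : ulm_closure G -> G)).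
  exact: cvg_snd.
exact: ulm_closure_val_continuous.
Qed.

HB.instance Definition _ := PreTopologicalNmodule_isTopologicalZmodule.Build
  (ulm_closure G) ulm_closure_sub_continuous.

End UlmClosureTopologicalGroup.

Section UlmClosureLCA.
Variable G : lcaType.

Lemma ulm_closure_hausdorff : hausdorff_space (ulm_closure G).
Proof.
move=> x y xy; apply/val_inj/(@lca_hausdorff G) => U V nU nV.
have [z [Uz Vz]] := xy _ _ (ulm_closure_val_continuous nU)
  (ulm_closure_val_continuous nV).
by exists (val z).
Qed.

Lemma ulm_closure_locally_compact : locally_compact [set: ulm_closure G].
Proof.
move=> x _; have [K nK [cK clK]] := @lca_locally_compact G (val x) I.
rewrite withinET in nK; exists (val @^-1` K).
  by rewrite withinET; exact: ulm_closure_val_continuous.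
split; last exact: (continuous_closedP _).1 (@ulm_closure_val_continuous G) _ clK.
move=> F PF FK; have [k [Kk clk]] := cK (val @ F) _ FK.
have Hk : in_closure_ulm G k.
  apply/mem_set; have /closure_id -> := @closed_closure G (ulm G).
  move=> U nU; apply: clk => //; apply: (@filterE _ F) => y.
  exact: (set_mem (valP y)).
exists (exist _ k Hk); split=> // S N FS /ulm_closure_nbhsP[V nV VN].
have [_ [[y Sy <-] Vy]] := clk (val @` S) V
  (@filterS _ F _ _ _ (fun y Sy => ex_intro2 _ _ y Sy erefl) FS) nV.
by exists y; split=> //; exact: VN.
Qed.

HB.instance Definition _ := isLCA.Build (ulm_closure G)
  ulm_closure_hausdorff ulm_closure_locally_compact.

End UlmClosureLCA.

Section UlmClosureMap.
Variables (A B : lcaType) (f : lcaHom A B).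

Lemma ulm_closure_map_subproof (x : ulm_closure A) :
  in_closure_ulm B (f (val x)).
Proof.
case: x => x /= /set_mem cx; apply/mem_set => U nU.
have [y [uy Uy]] := cx _ (@cts_fun _ _ f x U nU).
exists (f y); split=> // n n0.
by have [z _ <-] := uy n n0; exists (f z) => //; rewrite raddfMn.
Qed.

Definition ulm_closure_map (x : ulm_closure A) : ulm_closure B :=
  exist _ (f (val x)) (ulm_closure_map_subproof x).

Lemma ulm_closure_map_continuous : continuous ulm_closure_map.
Proof.
apply: ulm_closure_continuous => x.
apply: (@continuous_comp _ _ _ (val : ulm_closure A -> A) f).
  exact: ulm_closure_val_continuous.
exact: cts_fun.
Qed.

Lemma ulm_closure_map_additive : zmod_morphism ulm_closure_map.
Proof. by move=> x y; apply/val_inj; rewrite /= !raddfB. Qed.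

HB.instance Definition _ := isContinuous.Build (ulm_closure A) (ulm_closure B)
  ulm_closure_map ulm_closure_map_continuous.
HB.instance Definition _ := GRing.isZmodMorphism.Build
  (ulm_closure A) (ulm_closure B) ulm_closure_map ulm_closure_map_additive.

End UlmClosureMap.

(* An alias is needed because prod already carries, for topological vector
   spaces only, a canonical structure of topological group. *)
Definition dsum (A C : Type) : Type := (A * C)%type.

Section DirectSum.
Variables A C : lcaType.

HB.instance Definition _ := GRing.Zmodule.copy (dsum A C) (A * C)%type.
HB.instance Definition _ := Topological.copy (dsum A C) (A * C)%type.

Lemma dsum_sub_continuous :
  continuous (fun x : dsum A C * dsum A C => x.1 - x.2).
Proof.
move=> [[a c] [a' c']] U [[V W] [/= nV nW] VWU].
have [[V1 V2] [/= nV1 nV2] V12] := @sub_continuous A (a, a') V nV.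
have [[W1 W2] [/= nW1 nW2] W12] := @sub_continuous C (c, c') W nW.
exists (V1 `*` W1, V2 `*` W2) => /=.
  by split; [exists (V1, W1)|exists (V2, W2)].
move=> [[u v] [u' v']] [/= [Vu Wv] [Vu' Wv']]; apply: VWU; split=> /=.
  exact: (V12 (u, u')).
exact: (W12 (v, v')).
Qed.

HB.instance Definition _ := PreTopologicalNmodule_isTopologicalZmodule.Build
  (dsum A C) dsum_sub_continuous.

Lemma dsum_hausdorff : hausdorff_space (dsum A C).
Proof.
have nX (x : dsum A C) (U : set A) (V : set C) :
    nbhs x.1 U -> nbhs x.2 V -> nbhs x (U `*` V).
  by move=> nU nV; exists (U, V).
move=> [a c] [a' c'] ac; congr pair.
  apply: (@lca_hausdorff A) => U V nU nV.
  have [[z t] [[/= Uz _] [/= Vz _]]] := ac (U `*` setT) (V `*` setT)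
    (nX (a, c) _ _ nU filterT) (nX (a', c') _ _ nV filterT).
  by exists z.
apply: (@lca_hausdorff C) => U V nU nV.
have [[z t] [[/= _ Ut] [/= _ Vt]]] := ac (setT `*` U) (setT `*` V)
  (nX (a, c) _ _ filterT nU) (nX (a', c') _ _ filterT nV).
by exists t.
Qed.

Lemma dsum_locally_compact : locally_compact [set: dsum A C].
Proof.
move=> [a c] _; have [K nK [cK clK]] := @lca_locally_compact A a I.
have [L nL [cL clL]] := @lca_locally_compact C c I.
rewrite withinET in nK; rewrite withinET in nL.
have cKL := compact_setX cK cL.
exists (K `*` L); last by split=> //; exact: compact_closed dsum_hausdorff cKL.
by rewrite withinET; exists (K, L).
Qed.

HB.instance Definition _ := isLCA.Build (dsum A C)
  dsum_hausdorff dsum_locally_compact.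

Definition dsum_inl (a : A) : dsum A C := (a, 0).
Definition dsum_snd (x : dsum A C) : C := x.2.

Lemma dsum_inl_continuous : continuous dsum_inl.
Proof. by move=> a; apply: cvg_pair; [exact: cvg_id|exact: cvg_cst]. Qed.

Lemma dsum_inl_additive : zmod_morphism dsum_inl.
Proof. by move=> a b; congr pair; rewrite subr0. Qed.

Lemma dsum_snd_continuous : continuous dsum_snd.
Proof. by move=> x; exact: cvg_snd. Qed.

Lemma dsum_snd_additive : zmod_morphism dsum_snd.
Proof. by []. Qed.

HB.instance Definition _ :=
  isContinuous.Build A (dsum A C) dsum_inl dsum_inl_continuous.
HB.instance Definition _ :=
  GRing.isZmodMorphism.Build A (dsum A C) dsum_inl dsum_inl_additive.
HB.instance Definition _ :=
  isContinuous.Build (dsum A C) C dsum_snd dsum_snd_continuous.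
HB.instance Definition _ :=
  GRing.isZmodMorphism.Build (dsum A C) C dsum_snd dsum_snd_additive.

End DirectSum.

(* Openness onto the image, the image carrying the subspace topology. *)
Definition proper_hom (A B : lcaType) (f : lcaHom A B) : Prop :=
  forall U, open U -> exists2 V, open V & f @` U = V `&` range f.

Record is_extension (A B C : lcaType) (phi : lcaHom A B) (psi : lcaHom B C)
    : Prop := IsExtension {
  ext_injective : injective phi;
  ext_exact : range phi = psi @^-1` [set 0];
  ext_surjective : range psi = [set: C];
  ext_proper_phi : proper_hom phi;
  ext_proper_psi : proper_hom psi
}.

Definition is_tfu_extension (A B C : lcaType)
    (phi : lcaHom A B) (psi : lcaHom B C) : Prop :=
  is_extension phi psi /\
  is_extension (ulm_closure_map phi) (ulm_closure_map psi).

Definition equivalent_extensions (A B X C : lcaType)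
    (phi1 : lcaHom A B) (psi1 : lcaHom B C)
    (phi2 : lcaHom A X) (psi2 : lcaHom X C) : Prop :=
  exists beta : lcaHom B X, exists2 gamma : lcaHom X B,
    cancel beta gamma /\ cancel gamma beta &
    beta \o phi1 =1 phi2 /\ psi2 \o beta =1 psi1.

Definition splits (A B C : lcaType)
    (phi : lcaHom A B) (psi : lcaHom B C) : Prop :=
  equivalent_extensions phi psi (@dsum_inl A C) (@dsum_snd A C).

(* Ext_tfu (C, A) = 0, i.e. every TFU extension of A by C splits. *)
Definition ext_tfu_eq0 (C A : lcaType) : Prop :=
  forall (B : lcaType) (phi : lcaHom A B) (psi : lcaHom B C),
    is_tfu_extension phi psi -> splits phi psi.

(* Main.v *)
Require Import Defs.
From HB Require Import structures.
From mathcomp Require Import all_boot all_order all_algebra.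
From mathcomp Require Import generic_quotient ring_quotient.
From mathcomp Require Import all_classical reals Rstruct.
From mathcomp Require Import topology tvs normedtype.

Set Implicit Arguments.
Unset Strict Implicit.
Unset Printing Implicit Defensive.

Import Order.TTheory GRing.Theory Num.Theory.
Local Open Scope classical_set_scope.
Local Open Scope ring_scope.

(** The hypothesis forces A = 0. If g generates an infinite discrete subgroup
    of G and a is in A, the pushout (G x A) / <(g, - a)> is an extension of A by
    G / <g>; if it splits, there is a continuous homomorphism h : G -> A with
    h g = a.
    For G = Z and g = n > 0 this extension is always TFU: G / <g> is killed by
    n, so its Ulm subgroup is 0, and an element of A which is divisible by n m
    in the pushout is divisible by m in A. Hence a = n h(1), and A is divisible.
    For G the reals and g = 1, all groups are now divisible, so the extension is
    TFU; as A is discrete, h is constant, and a = 0. *)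

(** * Translations, and closedness of discrete subgroups *)

Lemma continuous_shift (G : topologicalZmodType) (c : G) :
  continuous (fun x : G => x + c).
Proof.
move=> x; apply: (@continuous_comp _ _ _ (fun y : G => (y, c))
  (fun z : G * G => z.1 + z.2)).
  by apply: cvg_pair; [exact: cvg_id|exact: cvg_cst].
exact: add_continuous.
Qed.

Definition isolates0 (G : topologicalZmodType) (H : {pred G}) (U : set G) :=
  nbhs (0 : G) U /\ forall x, U x -> x \in H -> x = 0.

(* Two points of H in a common small translate of U differ by an element of
   H `&` U, so every point of G has a neighbourhood meeting H at most once. *)
Lemma isolates0_closed (G : lcaType) (H : zmodClosed G) (U : set G) :
  isolates0 H U -> closed [set` H].
Proof.
move=> [nU HU] x clx.
have nU' : nbhs ((x, x).1 - (x, x).2) U by rewrite /= subrr.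
have [[V W] [/= nV nW] VW] := @sub_continuous G (x, x) U nU'.
have nVW : nbhs x (V `&` W) by exact: filterI.
have [h [Hh [Vh Wh]]] := clx _ nVW.
suff -> : x = h by [].
apply: (@lca_hausdorff G) => P Q nP nQ.
have [k [Hk [[Vk Wk] Pk]]] := clx _ (filterI nVW nP).
exists h; split; last exact: nbhs_singleton.
suff <- : k = h by [].
apply/eqP; rewrite -subr_eq0; apply/eqP/HU; first exact: (VW (k, h)).
exact: rpredB.
Qed.

(** * Quotients of locally compact groups by closed subgroups *)

Section QuotientGroup.
Variables (G : lcaType) (H : zmodClosed G).

(** The proof of closedness is an argument of the type, so that the Hausdorff instance can be
    attached to it. *)
Definition lquot (clH : closed [set` H]) : Type := Quotient.quot H.

Variable clH : closed [set` H].
Local Notation Q := (lquot clH).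

HB.instance Definition _ := GRing.Zmodule.copy Q (Quotient.quot H).
HB.instance Definition _ :=
  Topological.copy Q (quotient_topology (Quotient.quot H)).

Definition lproj (x : G) : Q := (\pi_(Quotient.quot H) x)%qT.

(* The library's quotient_topology is not used because its choiceType
   structure differs from the one underlying the group structure of Q. *)
Definition lquot_open : set_system Q := [set U | open (lproj @^-1` U)].

Lemma lquot_openT : lquot_open setT.
Proof. exact: openT. Qed.

Lemma lquot_openI : setI_closed lquot_open.
Proof. by move=> U V; exact: openI. Qed.

Lemma lquot_open_bigcup (I : Type) (U : I -> set Q) :
  (forall i, lquot_open (U i)) -> lquot_open (\bigcup_i U i).
Proof. by move=> oU; apply: bigcup_open => i _; exact: oU. Qed.

HB.instance Definition _ :=
  isOpenTopological.Build Q lquot_openT lquot_openI lquot_open_bigcup.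

Lemma lproj_zmod_morphism : zmod_morphism lproj.
Proof. exact: pi_is_zmod_morphism. Qed.

HB.instance Definition _ :=
  GRing.isZmodMorphism.Build G Q lproj lproj_zmod_morphism.

Lemma lproj_continuous : continuous lproj.
Proof. exact/continuousP. Qed.

HB.instance Definition _ := isContinuous.Build G Q lproj lproj_continuous.

Lemma lproj_eq (x y : G) : lproj x = lproj y <-> x - y \in H.
Proof. by rewrite Quotient.idealrBE; split=> /eqP. Qed.

Lemma lproj_surj (q : Q) : exists x, lproj x = q.
Proof. by exists (repr q); rewrite /lproj reprK. Qed.

(** The saturation of [U] is the union of its translates by elements of [H]. *)
Lemma lproj_open (U : set G) : open U -> open (lproj @` U).
Proof.
(* Openness in [Q] is by definition openness of the preimage in [G]. *)
move=> oU; change (open (lproj @^-1` (lproj @` U))).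
have -> : lproj @^-1` (lproj @` U) =
    \bigcup_(h in [set` H]) ((fun x => x + h) @^-1` U).
  apply/seteqP; split=> [x [y Uy /lproj_eq yx]|x [h Hh Uxh]] /=.
    by exists (y - x) => //=; rewrite addrC subrK.
  exists (x + h) => //; apply/lproj_eq.
  by rewrite addrAC subrr add0r.
apply: bigcup_open => h _; apply: open_comp => // x _.
exact: continuous_shift.
Qed.

Lemma lproj_nbhs (x : G) (U : set G) : nbhs x U -> nbhs (lproj x) (lproj @` U).
Proof.
rewrite nbhsE => -[V [oV Vx] VU]; rewrite nbhsE.
exists (lproj @` V); last exact: image_subset.
by split; [exact: lproj_open|exists x].
Qed.

Lemma lquot_sub_continuous : continuous (fun z : Q * Q => z.1 - z.2).
Proof.
move=> [p q] U nU; have [x xp] := lproj_surj p; have [y yq] := lproj_surj q.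
have nU' : nbhs (x - y) (lproj @^-1` U).
  by apply: lproj_continuous; rewrite raddfB /= xp yq.
have [[V W] [/= nV nW] VW] := @sub_continuous G (x, y) _ nU'.
exists (lproj @` V, lproj @` W) => /=.
  by rewrite -xp -yq; split; exact: lproj_nbhs.
move=> [_ _] /= [[v Vv <-] [w Ww <-]]; rewrite -raddfB.
exact: (VW (v, w)).
Qed.

HB.instance Definition _ := PreTopologicalNmodule_isTopologicalZmodule.Build
  Q lquot_sub_continuous.

(** If [x - y] is not in the closed subgroup [H], continuity of subtraction gives [V] and [W] around
    [x] and [y] whose differences avoid [H]; their images are then disjoint. *)
Lemma lquot_hausdorff : hausdorff_space Q.
Proof.
move=> p q; have [x <-] := lproj_surj p; have [y <-] := lproj_surj q => xy.
apply/lproj_eq; apply: contrapT => xyH.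
have nxy : nbhs (x - y) (~` [set` H]).
  by apply: open_nbhs_nbhs; split=> //; exact: closed_openC.
have [[V W] [/= nV nW] VW] := @sub_continuous G (x, y) _ nxy.
have [_ [[v Vv <-] [w Ww /esym/lproj_eq vw]]] :=
  xy _ _ (lproj_nbhs nV) (lproj_nbhs nW).
exact: (VW (v, w)) vw.
Qed.

Lemma lquot_locally_compact : locally_compact [set: Q].
Proof.
move=> q _; have [x <-] := lproj_surj q.
have [K nK [cK clK]] := @lca_locally_compact G x I.
rewrite withinET in nK; exists (lproj @` K).
  by rewrite withinET; exact: lproj_nbhs.
have cpK : compact (lproj @` K).
  apply: continuous_compact cK; apply: continuous_subspaceT.
  exact: lproj_continuous.
by split=> //; exact: compact_closed lquot_hausdorff cpK.
Qed.

HB.instance Definition _ := isLCA.Build Q lquot_hausdorff lquot_locally_compact.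

End QuotientGroup.

(** * A TFU criterion for extensions with open Ulm subgroup *)

(** This is the fact that open subgroups are closed: near a point [x] of the closure, the elements
    [y] with [x - y] in the subgroup form a neighbourhood, which meets the subgroup. *)
Lemma open_ulm_closed (G : topologicalZmodType) :
  open (ulm G) -> closure (ulm G) `<=` ulm G.
Proof.
move=> oU x clx.
have nx : nbhs x ((fun y => - y + x) @^-1` ulm G).
  apply: open_nbhs_nbhs; split; last by rewrite /= addNr; exact: ulm0.
  apply: open_comp => // y _.
  apply: (@continuous_comp _ _ _ (-%R : G -> G) (fun z : G => z + x)).
    exact: opp_continuous.
  exact: continuous_shift.
have [h [uh /= uxh]] := clx _ nx.
rewrite -[x](addNKr h) addrC -[h in _ + h]opprK.
by apply: ulmB => //; rewrite -sub0r; apply: ulmB => //; exact: ulm0.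
Qed.

Lemma ulm_map (A B : lcaType) (f : lcaHom A B) (x : A) :
  ulm A x -> ulm B (f x).
Proof.
by move=> ux n /ux[y _ <-]; exists (f y) => //; rewrite raddfMn.
Qed.

Section TFUCriterion.
Variables (A B C : lcaType) (phi : lcaHom A B) (psi : lcaHom B C).

(** Since [psi] is open, [ulm C] is open too, so [ulm B] and [ulm C] equal their closures. The two
    inclusions then yield exactness in the middle and surjectivity. *)
Lemma tfu_of_open_ulm : is_extension phi psi -> open (ulm B) ->
  phi @^-1` ulm B `<=` ulm A -> ulm C `<=` psi @` ulm B ->
  is_tfu_extension phi psi.
Proof.
move=> ext oB phiB psiC; split=> //; case: ext => phiI exct surj openphi openpsi.
have psi_open (U : set B) : open U -> open (psi @` U).
  by move=> /openpsi[V oV ->]; rewrite surj setIT.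
have psiB : psi @` ulm B = ulm C.
  by apply/seteqP; split=> // _ [b ub <-]; exact: ulm_map.
have oC : open (ulm C) by rewrite -psiB; exact: psi_open.
have inB (b : ulm_closure B) : ulm B (val b).
  by apply: open_ulm_closed => //; exact/set_mem/(valP b).
have toB (b : B) : ulm B b -> in_closure_ulm B b.
  by move=> ub; exact/mem_set/subset_closure.
split.
- by move=> x y /(congr1 val)/= /phiI; exact: val_inj.
- apply/seteqP; split=> [_ [x _ <-]|b /(congr1 val)/= b0].
    apply: val_inj => /=.
    have : (psi @^-1` [set 0]) (phi (val x)) by rewrite -exct; exists (val x).
    exact.
  have : range phi (val b) by rewrite exct.
  move=> [x _ xb]; have ux : ulm A x by apply: phiB; rewrite /= xb.
  have cx : in_closure_ulm A x by exact/mem_set/subset_closure.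
  by exists (exist _ x cx) => //; exact: val_inj.
- apply/seteqP; split=> // c _.
  have uc : ulm C (val c).
    by apply: open_ulm_closed => //; exact/set_mem/(valP c).
  have [b ub bc] := psiC _ uc.
  by exists (exist _ b (toB _ ub)) => //; exact: val_inj.
- move=> _ [U oU <-]; have [V oV UV] := openphi _ oU.
  exists (val @^-1` V); first by exists V.
  apply/seteqP; split=> [_ [x Ux <-]|b [/= Vb [x _ xb]]].
    split; last by exists x.
    have : (V `&` range phi) (phi (val x)) by rewrite -UV; exists (val x).
    by case.
  exists x => //=.
  have : (phi @` U) (val b) by rewrite UV; split=> //; rewrite -xb; exists (val x).
  by rewrite -xb => -[y Uy /phiI <-].
(* Cutting [U] down to [ulm B] keeps it open, and this is where openness of [ulm B] makes the
   restricted map proper. *)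
- move=> _ [U oU <-]; exists (val @^-1` (psi @` (U `&` ulm B))).
    by exists (psi @` (U `&` ulm B)) => //; apply: psi_open; exact: openI.
  apply/seteqP; split=> [_ [b Ub <-]|c [[b [Ub ub] bc] _]].
    by split; [exists (val b); split=> //; exact: inB|exists b].
  by exists (exist _ b (toB _ ub)) => //; exact: val_inj.
Qed.

End TFUCriterion.

(** * Infinite discrete cyclic subgroups *)

Definition cyclic (V : zmodType) (x : V) : {pred V} :=
  fun y => `[< exists k : int, y = x *~ k >].

Lemma cyclicP (V : zmodType) (x y : V) :
  reflect (exists k : int, y = x *~ k) (y \in cyclic x).
Proof. exact: asboolP. Qed.

Lemma cyclic_zmod_closed (V : zmodType) (x : V) : zmod_closed (cyclic x).
Proof.
split=> [|_ _ /cyclicP[k ->] /cyclicP[l ->]]; apply/cyclicP; first by exists 0.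
by exists (k - l); rewrite mulrzBr.
Qed.

HB.instance Definition _ (V : zmodType) (x : V) :=
  GRing.isZmodClosed.Build V (cyclic x) (cyclic_zmod_closed x).

(* U witnesses that g generates an infinite discrete subgroup. *)
Definition discrete_Z (G : topologicalZmodType) (g : G) (U : set G) :=
  nbhs (0 : G) U /\ forall k : int, U (g *~ k) -> k = 0.

Lemma cyclic_closed (G : lcaType) (g : G) (U : set G) :
  discrete_Z g U -> closed [set` cyclic g].
Proof.
move=> [nU gU]; apply: (@isolates0_closed _ _ U); split=> // x Ux /cyclicP[k xk].
by move: Ux; rewrite xk => /gU ->.
Qed.

Lemma dsum_mulrz (G A : lcaType) (x : G) (y : A) (k : int) :
  ((x, y) : dsum G A) *~ k = (x *~ k, y *~ k).
Proof.
rewrite [LHS]surjective_pairing; congr pair.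
  exact: (raddfMz (fst : G * A -> G) k (x, y)).
exact: (raddfMz (snd : G * A -> A) k (x, y)).
Qed.

(* The pushout of Z -> G -> G / <g> along the homomorphism Z -> A sending
   1 to a. *)
Section Pushout.
Variables (G A : lcaType) (A_discrete : forall U : set A, open U).
Variables (g : G) (a : A) (U : set G) (gU : discrete_Z g U).

(** The first coordinate alone separates the multiples, so [a] may be arbitrary, torsion or not. *)
Lemma pushout_discrete_Z :
  discrete_Z ((g, - a) : dsum G A) (U `*` [set: A]).
Proof.
have [nU gU0] := gU; split.
  by exists (U, [set: A]) => //=; split=> //; exact: filterT.
by move=> k; rewrite dsum_mulrz => -[/= /gU0].
Qed.

Local Notation pushout := (lquot (cyclic_closed pushout_discrete_Z)).
Local Notation pushout_base := (lquot (cyclic_closed gU)).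
Local Notation pushout_proj := (lproj (cyclic_closed pushout_discrete_Z)).
Local Notation base_proj := (lproj (cyclic_closed gU)).

Lemma pushout_projP (x x' : G) (y y' : A) :
  pushout_proj (x, y) = pushout_proj (x', y') <->
  exists k : int, x - x' = g *~ k /\ y - y' = - a *~ k.
Proof.
split=> [/lproj_eq/cyclicP[k]|[k [xk yk]]].
  by rewrite dsum_mulrz => -[? ?]; exists k.
by apply/lproj_eq/cyclicP; exists k; rewrite dsum_mulrz -xk -yk.
Qed.

Lemma base_projP (x x' : G) :
  base_proj x = base_proj x' <-> exists k : int, x - x' = g *~ k.
Proof. by split=> [/lproj_eq/cyclicP|xk] //; exact/lproj_eq/cyclicP. Qed.

Lemma pushout_surj (q : pushout) : exists x y, pushout_proj (x, y) = q.
Proof. by have [[x y] <-] := lproj_surj q; exists x, y. Qed.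

Lemma base_surj (q : pushout_base) : exists x, base_proj x = q.
Proof. exact: lproj_surj. Qed.

Definition pushout_in (y : A) : pushout := pushout_proj (0, y).

Lemma pushout_in_continuous : continuous pushout_in.
Proof. by apply/continuousP => V _; exact: A_discrete. Qed.

Lemma pushout_in_additive : zmod_morphism pushout_in.
Proof.
move=> y z; rewrite /pushout_in -raddfB; congr (pushout_proj (_, _)).
by rewrite subr0.
Qed.

HB.instance Definition _ :=
  isContinuous.Build A pushout pushout_in pushout_in_continuous.
HB.instance Definition _ :=
  GRing.isZmodMorphism.Build A pushout pushout_in pushout_in_additive.

(** A representative is chosen; [pushout_outE] shows that the choice does not matter, as first
    coordinates of representatives differ by multiples of [g]. *)
Definition pushout_out (q : pushout) : pushout_base :=
  base_proj (repr (q : Quotient.quot _)).1.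

Lemma pushout_outE (x : G) (y : A) :
  pushout_out (pushout_proj (x, y)) = base_proj x.
Proof.
rewrite /pushout_out; set z := repr _.
have : pushout_proj z = pushout_proj (x, y).
  by rewrite /pushout_proj /= /lproj reprK.
case: z => x' y' /pushout_projP[k [xk _]] /=.
by apply/base_projP; exists k.
Qed.

Lemma pushout_out_continuous : continuous pushout_out.
Proof.
apply/continuousP => V oV; change (open (pushout_proj @^-1` (pushout_out @^-1` V))).
have -> : pushout_proj @^-1` (pushout_out @^-1` V) =
    fst @^-1` (base_proj @^-1` V).
  by apply/seteqP; split=> -[x y]; rewrite /= pushout_outE.
apply: open_comp; first by move=> x _; exact: cvg_fst.
by apply: open_comp => // x _; exact: cts_fun.
Qed.

Lemma pushout_out_additive : zmod_morphism pushout_out.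
Proof.
move=> p q; have [x [y <-]] := pushout_surj p; have [z [t <-]] := pushout_surj q.
rewrite (_ : _ - _ = pushout_proj (x - z, y - t)); last by rewrite -raddfB.
by rewrite !pushout_outE raddfB.
Qed.

HB.instance Definition _ := isContinuous.Build
  pushout pushout_base pushout_out pushout_out_continuous.
HB.instance Definition _ := GRing.isZmodMorphism.Build
  pushout pushout_base pushout_out pushout_out_additive.

Lemma pushout_extension :
  is_extension (pushout_in : lcaHom A pushout)
    (pushout_out : lcaHom pushout pushout_base).
Proof.
have [nU gU0] := gU; split.
- move=> y z /pushout_projP[k []]; rewrite subrr => gk yz.
  apply/eqP; rewrite -subr_eq0 yz (_ : k = 0) ?mulr0z //; apply: gU0.
  by rewrite -gk; exact: nbhs_singleton.
- apply/seteqP; split=> [_ [y _ <-]|q].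
    by rewrite /= pushout_outE raddf0.
  have [x [y <-]] := pushout_surj q; rewrite /= pushout_outE.
  rewrite -(raddf0 base_proj) => /base_projP[k]; rewrite subr0 => xk.
  (* The pairs [(0, y + a *~ k)] and [(g *~ k, y)] differ by [- k] times [(g, - a)]. *)
  exists (y + a *~ k) => //; apply/pushout_projP; exists (- k).
  by rewrite sub0r xk mulrNz mulNrz mulrNz opprK addrAC subrr add0r.
- apply/seteqP; split=> // q _; have [x <-] := base_surj q.
  by exists (pushout_proj (x, 0)) => //; exact: pushout_outE.
- move=> V _; move: (nU); rewrite nbhsE => -[W [oW W0] WU].
  (* As [W] lies in [U], it contains no nonzero multiple of [g]; hence a class of [W]*[V] that comes
     from [A] has first coordinate 0. *)
  exists (pushout_proj @` (W `*` V)).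
    apply: lproj_open; rewrite openE => -[x y] [/= Wx Vy].
    exists (W, V) => //=; split; apply: open_nbhs_nbhs; split=> //.
  apply/seteqP; split=> [_ [y Vy <-]|_ [[[x y] [/= Wx Vy] <-] [z _ zy]]].
    by split; [exists (0, y)|exists y].
  exists y => //; apply/pushout_projP.
  move/pushout_projP: zy => [k []]; rewrite sub0r => /(congr1 -%R).
  rewrite opprK => xk _; exists 0.
  have /eqP : - k = 0 by apply: gU0; rewrite mulrNz -xk; exact: WU.
  by rewrite oppr_eq0 xk => /eqP ->; rewrite subrr !mulr0z !oppr0.
(* Since [base_proj] is open, it remains to see that [fst] is open. *)
- move=> V oV; exists (base_proj @` (fst @` (pushout_proj @^-1` V))).
    apply: lproj_open; rewrite openE => _ [[x y] Vxy <-].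
    have : nbhs ((x, y) : dsum G A) (pushout_proj @^-1` V).
      by apply: open_nbhs_nbhs; split=> //; apply: open_comp => // z _; exact: cts_fun.
    move=> [[P Q] [/= nP nQ] PQ]; apply: filterS nP => z Pz.
    by exists (z, y) => //; apply: PQ; split=> //; exact: nbhs_singleton nQ.
  apply/seteqP; split=> [_ [q Vq <-]|_ [[_ [[x y] Vxy <-] <-] _]].
    split; last by exists q.
    move: Vq; have [x [y <-]] := pushout_surj q; rewrite /= pushout_outE => Vxy.
    by exists x => //; exists (x, y).
  by exists (pushout_proj (x, y)) => //=; rewrite pushout_outE.
Qed.

(** The first component of [beta] is a retraction onto [A]. Composed with the map from [G] to the
    pushout it gives [h], and [h g = a] because [(g, 0)] and [(0, a)] have the same class. *)
Lemma pushout_splits :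
  splits (pushout_in : lcaHom A pushout)
    (pushout_out : lcaHom pushout pushout_base) ->
  exists h : G -> A, [/\ zmod_morphism h, continuous h & h g = a].
Proof.
move=> [beta [gamma _ [beta_in _]]].
exists (fun x => (beta (pushout_proj (x, 0))).1); split.
- move=> x y; rewrite (_ : (x - y, 0) = ((x, 0) : dsum G A) - (y, 0)).
    by rewrite !raddfB.
  by congr pair; rewrite subrr.
- move=> x.
  apply: (@continuous_comp _ _ _ (fun y => beta (pushout_proj (y, 0))) fst).
    apply: (@continuous_comp _ _ _ (fun y => pushout_proj (y, 0)) beta).
      apply: (@continuous_comp _ _ _ (@dsum_inl G A) pushout_proj).
        exact: dsum_inl_continuous.
      exact: lproj_continuous.
    exact: cts_fun.
  exact: cvg_fst.
- have -> : pushout_proj (g, 0) = pushout_in a.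
    by apply/pushout_projP; exists 1; rewrite subr0 sub0r !mulr1z.
  by rewrite [beta _]beta_in.
Qed.

(** Only these three conditions on Ulm subgroups must be checked separately for the integers and the
    reals. *)
Lemma hom_of_pushout : ext_tfu_eq0 pushout_base A ->
  open (ulm pushout) -> (forall y, ulm pushout (pushout_proj (0, y)) -> ulm A y) ->
  ulm pushout_base `<=` pushout_out @` ulm pushout ->
  exists h : G -> A, [/\ zmod_morphism h, continuous h & h g = a].
Proof.
move=> ext0 oulm ulmA ulmC; apply/pushout_splits/ext0.
by apply: tfu_of_open_ulm => //; exact: pushout_extension.
Qed.

End Pushout.

(** * The integers and the reals as locally compact groups *)

Section DiscreteGroup.
Variable V : zmodType.
Local Notation D := (discrete_topology V).

HB.instance Definition _ := GRing.Zmodule.copy D V.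

Lemma discrete_sub_continuous : continuous (fun z : D * D => z.1 - z.2).
Proof.
move=> [x y] U nU; exists ([set x], [set y]) => /=.
  by split; exact: discrete_set1.
by move=> [_ _] [/= -> ->]; exact: nbhs_singleton nU.
Qed.

HB.instance Definition _ :=
  PreTopologicalNmodule_isTopologicalZmodule.Build D discrete_sub_continuous.

Lemma discrete_group_hausdorff : hausdorff_space D.
Proof. exact: discrete_hausdorff. Qed.

Lemma discrete_group_locally_compact : locally_compact [set: D].
Proof.
move=> x _; exists [set x]; first by rewrite withinET; exact: discrete_set1.
by split; [exact: compact_set1|exact: discrete_closed].
Qed.

HB.instance Definition _ :=
  isLCA.Build D discrete_group_hausdorff discrete_group_locally_compact.

End DiscreteGroup.

Local Notation Zd := (discrete_topology int).

Lemma discrete_Z_int (n : nat) : (0 < n)%N ->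
  @discrete_Z Zd (n%:Z : int) [set 0].
Proof.
move=> n0; split; first exact: discrete_set1.
move=> k; rewrite [_ *~ k](mulrzz (n%:Z) k) => /eqP.
by rewrite mulf_eq0 => /orP[/eqP[n00]|/eqP //]; rewrite n00 in n0.
Qed.

HB.instance Definition _ (R : realType) :=
  isLCA.Build R^o (@Rhausdorff R) (@locally_compactR R).

Lemma discrete_Z_real (R : realType) :
  @discrete_Z R^o (1 : R) (ball (0 : R^o) 1).
Proof.
split; first exact: nbhsx_ballx.
move=> k; rewrite /ball /= sub0r normrN -intr_norm (ltr_int R _ 1).
by rewrite -abszE ltz_nat ltnS leqn0 absz_eq0 => /eqP.
Qed.

(** Fibres of [h] are open and closed, and the line is connected. *)
Lemma real_hom_discrete0 (R : realType) (A : lcaType) (h : R^o -> A) :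
  (forall U : set A, open U) -> continuous h -> forall x y, h x = h y.
Proof.
move=> A_discrete ch x y.
have cR : connected [set: R^o] by exact/connected_intervalP.
have e : h @^-1` [set h y] = setT.
  apply: cR; first by exists y.
    exists (h @^-1` [set h y]); last by rewrite setTI.
    by apply: open_comp => // z _; exact: ch.
  exists (h @^-1` [set h y]); last by rewrite setTI.
  apply: closed_comp => [z _|]; first exact: ch.
  by rewrite -openC.
suff : (h @^-1` [set h y]) x by [].
by rewrite e.
Qed.

(** * Divisibility and vanishing of [A] *)

Section TrivialExt.
Variables (A : lcaType) (A_discrete : forall U : set A, open U).

Lemma ext_tfu_eq0_mulrn_surj (n : nat) (a : A) :
  (forall X : lcaType, ext_tfu_eq0 X A) -> (0 < n)%N -> exists b, b *+ n = a.
Proof.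
move=> ext0 n0.
have nZ := discrete_Z_int n0.
suff [h [hB _ <-]] : exists h : Zd -> A,
    [/\ zmod_morphism h, continuous h & h (n%:Z : int) = a].
  pose hA : {additive Zd -> A} :=
    HB.pack h (GRing.isZmodMorphism.Build Zd A h hB).
  exists (hA (1 : int)); rewrite -raddfMn; congr h.
  exact: (natz n).
apply: (hom_of_pushout A_discrete (gU := nZ)); first exact: ext0.
(* Both factors are discrete, so every subset of their product is open. *)
- change (open (lproj (cyclic_closed (pushout_discrete_Z a nZ)) @^-1`
    ulm (lquot (cyclic_closed (pushout_discrete_Z a nZ))))).
  rewrite openE => -[x y] xy.
  exists ([set x], [set y]) => /=.
    split; first exact: discrete_set1.
    by apply: open_nbhs_nbhs; split.
  by move=> [_ _] [/= -> ->].
- move=> y uy m m0.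
  (* Divisibility by [n * m] is used: if [n * m] times [(j, z)] has the class of [(0, y)], then
     [n m j = n k], so [k = m j] and [y = m (n z + j a)]. *)
  have nm0 : (0 < n * m)%N by rewrite muln_gt0 n0.
  have [q _] := uy _ nm0; have [j [z <-]] := pushout_surj q.
  rewrite -raddfMn pmulrn dsum_mulrz.
  move=> /pushout_projP[k [jk zk]].
  have kE : k = j * m%:Z.
    have jk' : (j : int) *~ (n * m)%N = (n%:Z : int) *~ k.
      by move: jk; rewrite subr0.
    have nZ0 : (n%:Z : int) != 0 by rewrite eqz_nat -lt0n.
    apply: (mulfI nZ0); rewrite -mulrzz -jk' mulrzz PoszM.
    by rewrite mulrCA.
  exists (z *+ n + a *~ j) => //.
  rewrite mulrnDl -mulrnA !pmulrn -mulrzA -kE.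
  by rewrite -[z *~ _](subrK y) zk mulNrz addrAC addNr add0r.
(* The base is killed by [n], so its element [q], being a multiple of [n], is 0. *)
- move=> q uq; have [q' _ <-] := uq n n0; have [x <-] := base_surj q'.
  exists 0; first exact: ulm0.
  (* The multiplier is [x] itself: [n] copies of [x] are [x] copies of the generator [n]. *)
  rewrite raddf0 -raddfMn -(raddf0 (lproj _)); apply/esym/base_projP; exists x.
  rewrite subr0 pmulrn.
  change ((x : int) *~ n%:Z = (n%:Z : int) *~ x); rewrite !mulrzz; exact: mulrC.
Qed.

Lemma ext_tfu_eq0_divisible_eq0 (a : A) :
  (forall X : lcaType, ext_tfu_eq0 X A) ->
  (forall n (b : A), (0 < n)%N -> exists c, c *+ n = b) -> a = 0.
Proof.
move=> ext0 divA; pose R := Rdefinitions.R.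
suff [h [hB ch <-]] : exists h : R^o -> A,
    [/\ zmod_morphism h, continuous h & h (1 : R) = a].
  (* The constant [h] takes its value at 0, and [hB] applied to [0 - 0] shows that this value is
     0. *)
  by rewrite (real_hom_discrete0 A_discrete ch _ 0) -(subrr 0) hB subrr.
(* Division is carried out componentwise, by [divA] in [A]. *)
have ulmT : ulm (lquot (cyclic_closed
    (pushout_discrete_Z a (discrete_Z_real R)))) = setT.
  apply/seteqP; split=> // q _ n n0; have [x [y <-]] := pushout_surj q.
  have [z <-] := divA n y n0.
  have xn : (x : R) / n%:R *+ n = x.
    by rewrite -mulr_natr divfK // pnatr_eq0 -lt0n.
  exists (lproj _ ((x / n%:R, z) : dsum R^o A)) => //.
  by rewrite -raddfMn pmulrn dsum_mulrz -!pmulrn xn.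
apply: (hom_of_pushout A_discrete (gU := discrete_Z_real R)); first exact: ext0.
- by rewrite ulmT; exact: openT.
- by move=> y _ n n0; have [c <-] := divA n y n0; exists c.
- rewrite ulmT => q _; have [x <-] := base_surj q.
  exists (lproj _ ((x, 0) : dsum R^o A)) => //; exact: pushout_outE.
Qed.

End TrivialExt.

Theorem lemma3p1 (A : lcaType) (A_discrete : forall U : set A, open U)
    (A_ext : forall X : lcaType, ext_tfu_eq0 X A) :
  reduced A /\ divisible [set: Quotient.quot (torsion A)].
Proof.
(* The integers provide the divisibility that the argument over the reals requires. *)
have A0 (a : A) : a = 0.
  apply: (ext_tfu_eq0_divisible_eq0 A_discrete) => // n b n0.
  exact: ext_tfu_eq0_mulrn_surj.
split=> [S _|n n0].
  by apply/seteqP; split=> [x _|x ->] /=; [exact: A0|exact: rpred0].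
apply/seteqP; split=> // q _; exists q => //.
have q0 : q = 0.
  rewrite -[q]reprK (A0 (repr q)).
  exact: (raddf0 (\pi_(Quotient.quot (torsion A)))%qT).
by rewrite q0 mul0rn.
Qed.
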